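(* Let $b,c_1,c_2$ be positive integers, let $\alpha/\beta$ be the right lobster $\mathcal{L}^{c_1,c_2}_b$, and let $c=\min(c_1,c_2)$. Then the minimal elements of $\mathrm{SET}(\alpha/\beta)$ are in bijection with the words in the letters $B$ and $C$ having exactly $b$ occurrences of $B$ and $c$ occurrences of $C$. Consequently $\mathrm{SET}(\alpha/\beta)$ has $\binom{b+c}{b}$ minimal elements, and $S^{\mathrm{col}}_{\alpha/\beta}$ is one of them.
   Context: Rows of skew diagrams are numbered from the bottom. The right lobster $\mathcal{L}^{c_1,c_2}_b$ is the skew diagram $\alpha/\beta$ with $\alpha=(b+1+c_2,b+1,b+1+c_1)$, $\beta=(b+1,1,b+1)$: a bottom row of $c_2$ cells in columns $b+2,\ldots,b+1+c_2$, a middle row of $b$ cells in columns $2,\ldots,b+1$, and a top row of $c_1$ cells in columns $b+2,\ldots,b+1+c_1$. $\mathrm{SET}(\alpha/\beta)$ is the set of bijective fillings with $1,\ldots,N$ ($N=b+c_1+c_2$) whose rows increase left to right and columns increase bottom to top. For $1\le i\le N-1$, $\pi_i(T)=T$ if $i+1$ is in a strictly higher row than $i$, $\pi_i(T)=s_i(T)$ (swap $i$ and $i+1$) if $i+1$ is in a strictly lower row than $i$, and $\pi_i(T)=0$ otherwise; the poset order is $T\le T'$ iff $T'$ is obtained from $T$ by a sequence of operators $\pi_i$ (all intermediate results nonzero); minimal elements are those with no strictly smaller element. $S^{\mathrm{col}}_{\alpha/\beta}$ is the tableau filled with $1,\ldots,N$ consecutively along columns bottom to top, from the leftmost column rightward.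 *)

(* Defs.v *)
From HB Require Import structures.
From mathcomp Require Import all_boot.

(* Skew diagrams alpha/beta, rows numbered from the bottom (row index 0 of the
   sequences = bottom row).  Columns are numbered from 1.  A cell is a pair
   (row, column); it belongs to the skew shape iff beta_r < column <= alpha_r. *)
Definition cell (alpha : seq nat) : finType :=
  ('I_(size alpha) * 'I_(\max_(a <- alpha) a).+1)%type.

Definition in_shape (alpha beta : seq nat) (x : cell alpha) : bool :=
  (nth 0 beta x.1 < x.2) && (x.2 <= nth 0 alpha x.1).

Definition ncells (alpha beta : seq nat) : nat :=
  #|[pred x : cell alpha | in_shape alpha beta x]|.

(* A filling: value in {1..N} on cells of the shape, 0 (= empty) outside. *)
Definition tableau (alpha beta : seq nat) : finType :=
  {ffun cell alpha -> 'I_(ncells alpha beta).+1}.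

Definition is_SET (alpha beta : seq nat) (T : tableau alpha beta) : bool :=
  [&& [forall x, (~~ in_shape alpha beta x) ==> (val (T x) == 0)],
      [forall x, in_shape alpha beta x ==> (0 < T x)],
      [forall x, forall y,
         [&& in_shape alpha beta x, in_shape alpha beta y & T x == T y] ==> (x == y)],
      [forall k : 'I_(ncells alpha beta).+1,
         (0 < k) ==> [exists x, in_shape alpha beta x && (T x == k)]],
      [forall x, forall y,
         [&& in_shape alpha beta x, in_shape alpha beta y, x.1 == y.1 & x.2 < y.2]
           ==> (T x < T y)] &
      [forall x, forall y,
         [&& in_shape alpha beta x, in_shape alpha beta y, x.2 == y.2 & x.1 < y.1]
           ==> (T x < T y)]].

Definition rowof (alpha beta : seq nat) (T : tableau alpha beta) (i : nat) : nat :=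
  if [pick x | in_shape alpha beta x && (val (T x) == i)] is Some x then val x.1 else 0.

Definition swapT (alpha beta : seq nat) (T : tableau alpha beta) (i : nat)
  : tableau alpha beta :=
  [ffun x => if val (T x) == i then inord i.+1
             else if val (T x) == i.+1 then inord i else T x].

Arguments rowof {alpha beta}.
Arguments swapT {alpha beta}.

(* the operator pi_i; None stands for the result 0 *)
Definition pi_op (alpha beta : seq nat) (T : tableau alpha beta) (i : nat)
  : option (tableau alpha beta) :=
  if rowof T i < rowof T i.+1 then Some T
  else if rowof T i.+1 < rowof T i then Some (swapT T i)
  else None.

Arguments pi_op {alpha beta}.

Definition pi_step (alpha beta : seq nat) : rel (tableau alpha beta) :=
  fun T T' => [exists i : 'I_(ncells alpha beta), (0 < i) && (pi_op T i == Some T')].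

Definition tab_le (alpha beta : seq nat) (T T' : tableau alpha beta) : bool :=
  connect (@pi_step alpha beta) T T'.

Arguments is_SET {alpha beta}.
Arguments tab_le {alpha beta}.

Definition is_minimal (alpha beta : seq nat) (T : tableau alpha beta) : bool :=
  is_SET T &&
  [forall T' : tableau alpha beta, (is_SET T' && tab_le T' T) ==> (T' == T)].

Arguments is_minimal {alpha beta}.

(* S^col: fill consecutively along columns, bottom to top, leftmost column first *)
Definition Scol (alpha beta : seq nat) : tableau alpha beta :=
  [ffun x => if in_shape alpha beta x then
       inord #|[pred y : cell alpha | in_shape alpha beta y &&
                 ((y.2 < x.2) || ((y.2 == x.2) && (y.1 <= x.1)))]|
     else inord 0].

Definition lobster_alpha (b c1 c2 : nat) : seq nat := [:: b.+1 + c2; b.+1; b.+1 + c1].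
Definition lobster_beta (b : nat) : seq nat := [:: b.+1; 1; b.+1].

(* words in the letters B (= true) and C (= false) with b B's and c C's *)
Definition BCword (b c : nat) : Type := {w : (b + c).-tuple bool | count id w == b}.

(* Main.v *)
(* A tableau T is minimal iff, whenever i+1 lies in a strictly higher row than
   i, exchanging the two does not give a tableau in SET, and this means that
   they share a column.  A tableau is determined by its row word, whose
   i-th letter is the row of the entry i, and for the lobster minimality says
   that the only ascents of the row word are factors 02 whose cells share a
   column.  Reading from the left, such a word is a product of blocks 1 and 02,
   except that the surplus of one claw has a forced place: surplus letters 2
   directly follow the last block 02, surplus letters 0 end the word.  Hence the
   word is determined by the sequence of blocks, B = 1 and C = 02. *)
Require Import Defs.
From HB Require Import structures.
From mathcomp Require Import all_boot zify.

Set Implicit Arguments.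
Unset Strict Implicit.
Unset Printing Implicit Defensive.

(** * Minimality as a local condition *)

Record SET_spec (alpha beta : seq nat) (T : tableau alpha beta) : Prop := {
  SET_out : forall x, ~~ in_shape alpha beta x -> T x = 0 :> nat;
  SET_pos : forall x, in_shape alpha beta x -> 0 < T x;
  SET_inj : forall x y, in_shape alpha beta x -> in_shape alpha beta y ->
    T x = T y :> nat -> x = y;
  SET_surj : forall k, 0 < k <= ncells alpha beta ->
    exists2 x, in_shape alpha beta x & T x = k :> nat;
  SET_row : forall x y, in_shape alpha beta x -> in_shape alpha beta y ->
    x.1 = y.1 :> nat -> x.2 < y.2 -> T x < T y;
  SET_col : forall x y, in_shape alpha beta x -> in_shape alpha beta y ->
    x.2 = y.2 :> nat -> x.1 < y.1 -> T x < T y }.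

Lemma SETP (alpha beta : seq nat) (T : tableau alpha beta) :
  reflect (SET_spec T) (is_SET T).
Proof.
apply: (iffP idP).
  case/and5P=> /forallP h0 /forallP h1 /forallP h2 /forallP h3 /andP[/forallP h4 /forallP h5].
  split.
  - by move=> x xo; apply/eqP/(implyP (h0 x)).
  - by move=> x xi; apply: (implyP (h1 x)).
  - move=> x y xi yi e; apply/eqP/(implyP (forallP (h2 x) y)).
    by rewrite xi yi; apply/eqP/val_inj.
  - move=> k /andP[k0 kN].
    have := implyP (h3 (Ordinal (kN : k < (ncells alpha beta).+1))) k0.
    by case/existsP=> x /andP[xi /eqP e]; exists x; rewrite // e.
  - move=> x y xi yi e l; apply: (implyP (forallP (h4 x) y)).
    by rewrite xi yi l andbT; apply/eqP/val_inj.
  - move=> x y xi yi e l; apply: (implyP (forallP (h5 x) y)).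
    by rewrite xi yi l andbT; apply/eqP/val_inj.
case=> h0 h1 h2 h3 h4 h5; apply/and5P; split; last (apply/andP; split).
- by apply/forallP=> x; apply/implyP=> xo; apply/eqP/h0.
- by apply/forallP=> x; apply/implyP; apply: h1.
- apply/forallP=> x; apply/forallP=> y; apply/implyP=> /and3P[xi yi /eqP e].
  by apply/eqP/h2 => //; rewrite e.
- apply/forallP=> k; apply/implyP=> k0; apply/existsP.
  have kN : 0 < k <= ncells alpha beta by rewrite k0 -ltnS ltn_ord.
  case: (h3 _ kN) => x xi e; exists x; rewrite xi; exact/eqP/val_inj.
- apply/forallP=> x; apply/forallP=> y; apply/implyP=> /and4P[xi yi /eqP e l].
  by apply: h4; rewrite ?e.
- apply/forallP=> x; apply/forallP=> y; apply/implyP=> /and4P[xi yi /eqP e l].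
  by apply: h5; rewrite ?e.
Qed.

Lemma tableau_le (alpha beta : seq nat) (T : tableau alpha beta) x :
  T x <= ncells alpha beta.
Proof. by rewrite -ltnS ltn_ord. Qed.

Lemma rowofE (alpha beta : seq nat) (T : tableau alpha beta) x :
  is_SET T -> in_shape alpha beta x -> rowof T (T x) = x.1.
Proof.
move=> /SETP S xi; rewrite /rowof; case: pickP => [y /andP[yi /eqP e]|/(_ x)].
  by rewrite (SET_inj S yi xi e).
by rewrite xi eqxx.
Qed.

Lemma swapTE (alpha beta : seq nat) (T : tableau alpha beta) i x :
  i < ncells alpha beta ->
  swapT T i x = (if T x == i :> nat then i.+1
                 else if T x == i.+1 :> nat then i else T x) :> nat.
Proof.
move=> iN; rewrite ffunE; case: ifP => _; first by rewrite inordK.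
by case: ifP => _ //; rewrite inordK // ltnS ltnW.
Qed.

Lemma swapTK (alpha beta : seq nat) (T : tableau alpha beta) i :
  i < ncells alpha beta -> swapT (swapT T i) i = T.
Proof.
move=> iN; apply/ffunP=> u.
suff E : swapT (swapT T i) i u = T u :> nat by exact: val_inj.
rewrite !swapTE //; have [->|ni] := eqVneq (T u : nat) i.
  by rewrite gtn_eqF // eqxx.
by have [->|nj] := eqVneq (T u : nat) i.+1; rewrite ?eqxx // (negbTE ni) (negbTE nj).
Qed.

(* Exchanging i and i+1 can only break a row or column inequality between
   the two cells holding these values. *)
Lemma swapT_SET (alpha beta : seq nat) (T : tableau alpha beta) x y :
  is_SET T -> in_shape alpha beta x -> in_shape alpha beta y ->
  T y = (T x).+1 :> nat -> x.1 != y.1 :> nat -> x.2 != y.2 :> nat ->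
  is_SET (swapT T (T x)).
Proof.
move=> /SETP S xi yi e n1 n2.
have iN : T x < ncells alpha beta by rewrite -e tableau_le.
have ltS u v : in_shape alpha beta u -> in_shape alpha beta v ->
    T u < T v -> ~ (u = x /\ v = y) -> swapT T (T x) u < swapT T (T x) v.
  move=> ui vi l n; rewrite !swapTE //.
  have [eu|nu] := eqVneq (T u : nat) (T x).
    have eux := SET_inj S ui xi eu.
    have : T v <> (T x).+1 :> nat by rewrite -e => /(SET_inj S vi yi) ev; apply: n.
    by do ?case: ifP => [/eqP ?|/eqP ?]; lia.
  by do ?case: ifP => [/eqP ?|/eqP ?]; lia.
apply/SETP; split.
- move=> u uo; have u0 := SET_out S uo; have x0 := SET_pos S xi.
  by rewrite swapTE // u0; do ?case: ifP => [/eqP ?|/eqP ?]; lia.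
- move=> u ui; have u0 := SET_pos S ui; have x0 := SET_pos S xi.
  by rewrite swapTE //; do ?case: ifP => [/eqP ?|/eqP ?]; lia.
- move=> u v ui vi euv; apply: (SET_inj S) => //.
  by move: euv; rewrite !swapTE //; do ?case: ifP => [/eqP ?|/eqP ?]; lia.
- move=> k kN; have [->|nk] := eqVneq k (T x).
    by exists y => //; rewrite swapTE // e eqxx; case: ifP => [/eqP ?|//]; lia.
  have [->|nk'] := eqVneq k (T x).+1; first by exists x => //; rewrite swapTE // eqxx.
  have [u ui eu] := SET_surj S kN; exists u => //; rewrite swapTE // eu.
  by rewrite (negbTE nk) (negbTE nk').
- move=> u v ui vi e1 l; apply: ltS => //; first exact: (SET_row S).
  by case=> eu ev; move: n1; rewrite -eu -ev e1 eqxx.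
- move=> u v ui vi e1 l; apply: ltS => //; first exact: (SET_col S).
  by case=> eu ev; move: n2; rewrite -eu -ev e1 eqxx.
Qed.

(** In the swapping case the two cells lie in different columns, because within a column the lower
    cell would hold the smaller entry. So [swapT_SET] applies and the step stays inside SET. *)
Lemma pi_op_SET (alpha beta : seq nat) (U T : tableau alpha beta) (i : nat) :
  is_SET U -> 0 < i < ncells alpha beta -> pi_op U i = Some T ->
  T = U \/ exists x y, [/\ in_shape alpha beta x, in_shape alpha beta y,
    U x = i :> nat, U y = i.+1 :> nat & y.1 < x.1 /\ x.2 != y.2 :> nat]
    /\ T = swapT U i.
Proof.
move=> SU /andP[i0 iN]; have /SETP S := SU.
have [|x xi ex] := SET_surj S (k := i); first by rewrite i0 ltnW.
have [|y yi ey] := SET_surj S (k := i.+1); first by [].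
have rx : rowof U i = x.1 by rewrite -ex rowofE.
have ry : rowof U i.+1 = y.1 by rewrite -ey rowofE.
rewrite /pi_op rx ry.
case: ifP => [_ [<-]|_]; first by left.
case: ifP => // l [<-]; right; exists x, y; do !split=> //.
apply/eqP=> e2; have := SET_col S yi xi (esym e2) l; lia.
Qed.

Definition locally_minimal (alpha beta : seq nat) (T : tableau alpha beta) : Prop :=
  forall x y, in_shape alpha beta x -> in_shape alpha beta y ->
    T y = (T x).+1 :> nat -> x.1 < y.1 -> x.2 = y.2 :> nat.

(** If [i+1] is strictly higher than [i] in another column, the exchanged filling [U] is in SET and
    [pi_op] sends it to [T]. Conversely no nontrivial step ends in a locally minimal tableau, so
    every chain up to [T] is constant. *)
Lemma is_minimalP (alpha beta : seq nat) (T : tableau alpha beta) :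
  reflect (is_SET T /\ locally_minimal T) (is_minimal T).
Proof.
apply: (iffP andP) => [[ST /forallP mT]|[ST lT]]; split=> //.
  move=> x y xi yi e l; apply/eqP; apply/negPn/negP => n2.
  have S := elimT (SETP T) ST; have x0 := SET_pos S xi.
  have iN : T x < ncells alpha beta by rewrite -e tableau_le.
  pose U := swapT T (T x).
  have SU : is_SET U by apply: (swapT_SET ST xi yi e) => //; rewrite neq_ltn l.
  have Ux : U x = (T x).+1 :> nat by rewrite swapTE // eqxx.
  have Uy : U y = T x :> nat by rewrite swapTE // e eqxx; case: ifP => [/eqP ?|//]; lia.
  have le : tab_le U T.
    apply: connect1; apply/existsP; exists (Ordinal iN) => /=.
    have ry : rowof U (T x) = y.1 by rewrite -Uy rowofE.
    have rx : rowof U (T x).+1 = x.1 by rewrite -Ux rowofE.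
    rewrite x0 /pi_op ry rx l ltnNge ltnW //=.
    by rewrite swapTK.
  have := mT U; rewrite SU le /= => /eqP eUT; move: Ux; rewrite eUT; lia.
apply/forallP=> U; apply/implyP=> /andP[SU /connectP[p]].
(* After an exchange [i+1] sits above [i] in another column, so the result is not locally
   minimal. *)
have step (V W : tableau alpha beta) : is_SET V -> pi_step alpha beta V W ->
    is_SET W /\ (locally_minimal W -> V = W).
  move=> SV /existsP[i /andP[i0 /eqP e]].
  have iN : 0 < i < ncells alpha beta by rewrite i0 ltn_ord.
  case: (pi_op_SET SV iN e) => [->//|[x [y [[xi yi ex ey [l n2]] ->]]]].
  split.
    by rewrite -ex; apply: (swapT_SET SV xi yi); rewrite ?ey ?ex // neq_ltn l orbT.
  move=> lm; case/eqP: n2; apply/esym/lm => //; rewrite !swapTE ?ltn_ord //.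
  by rewrite ex ey !eqxx; case: ifP => [/eqP ?|//]; lia.
(* The chain is unwound from its upper end: the induction hypothesis identifies [V] with the locally
   minimal tableau, so the step from [U] to [V] is trivial. *)
elim: p U SU => [U _ _ ->//|V p IH U SU /= /andP[st pa] eT].
have [SV eUV] := step _ _ SU st.
have /eqP eV := IH _ SV pa eT.
by apply/eqP; rewrite -eV; apply: eUV; rewrite eV.
Qed.

(** * Row words *)

Lemma nth_le_bigmax (s : seq nat) r : nth 0 s r <= \max_(a <- s) a.
Proof.
have [l|l] := ltnP r (size s); last by rewrite nth_default.
exact: (@leq_bigmax_seq _ _ xpredT id _ (mem_nth 0 l) isT).
Qed.

Lemma exists_cell (alpha : seq nat) r c : r < size alpha -> c <= nth 0 alpha r ->
  exists2 x : cell alpha, x.1 = r :> nat & x.2 = c :> nat.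
Proof.
move=> rs cr; have cm : c < (\max_(a <- alpha) a).+1.
  by rewrite ltnS (leq_trans cr) // nth_le_bigmax.
by exists (Ordinal rs, Ordinal cm).
Qed.

Lemma cell_eq (alpha : seq nat) (x y : cell alpha) :
  x.1 = y.1 :> nat -> x.2 = y.2 :> nat -> x = y.
Proof. by case: x y => [x1 x2] [y1 y2] /= /val_inj -> /val_inj ->. Qed.

Lemma sum_interval n a d : \sum_(j < n) (a < j <= d) = minn n d.+1 - a.+1.
Proof.
elim: n => [|n IH]; first by rewrite big_ord0; lia.
rewrite big_ord_recr /= IH; case: (ltnP a n); case: (leqP n d) => /=; lia.
Qed.

Lemma sum_row (alpha beta : seq nat) (F : nat -> nat) r : r < size alpha ->
  \sum_(x : cell alpha | in_shape alpha beta x && (x.1 == r :> nat)) F x.2 =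
  \sum_(j < (\max_(a <- alpha) a).+1) (nth 0 beta r < j <= nth 0 alpha r) * F j.
Proof.
move=> rs; rewrite big_mkcond /=.
pose G (i : 'I_(size alpha)) (j : 'I_(\max_(a <- alpha) a).+1) :=
  if (nth 0 beta i < j <= nth 0 alpha i) && (i == r :> nat) then F j else 0.
rewrite -[LHS](pair_bigA _ G) /= (bigD1 (Ordinal rs)) //= [X in _ + X]big1 ?addn0.
  by apply: eq_bigr => j _; rewrite /G /= eqxx andbT; case: ifP; rewrite ?mul1n.
move=> i ni; apply: big1 => j _; rewrite /G.
by rewrite (_ : (i == r :> nat) = false) ?andbF //; apply/negbTE.
Qed.

Lemma ncells_sum (alpha beta : seq nat) :
  ncells alpha beta = \sum_(r < size alpha) (nth 0 alpha r - nth 0 beta r).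
Proof.
rewrite /ncells -sum1_card big_mkcond /=.
pose G (i : 'I_(size alpha)) (j : 'I_(\max_(a <- alpha) a).+1) :=
  if (nth 0 beta i < j <= nth 0 alpha i) then 1 else 0.
rewrite -[LHS](pair_bigA _ G); apply: eq_bigr => i _.
rewrite -[X in _ = X](_ : minn (\max_(a <- alpha) a).+1 (nth 0 alpha i).+1 - (nth 0 beta i).+1 = _).
  by rewrite -sum_interval; apply: eq_bigr => j _; rewrite /G; case: ifP.
by have := nth_le_bigmax alpha i; lia.
Qed.

Definition row_word (alpha beta : seq nat) (T : tableau alpha beta) : seq nat :=
  mkseq (fun i => rowof T i.+1) (ncells alpha beta).

Lemma size_row_word (alpha beta : seq nat) (T : tableau alpha beta) :
  size (row_word T) = ncells alpha beta.
Proof. exact: size_mkseq. Qed.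

Lemma nth_row_word (alpha beta : seq nat) (T : tableau alpha beta) x i :
  is_SET T -> in_shape alpha beta x -> T x = i.+1 :> nat ->
  nth 0 (row_word T) i = x.1.
Proof.
move=> ST xi e; by rewrite nth_mkseq -?e ?rowofE ?tableau_le.
Qed.

(** Lengthening the prefix by one letter adds exactly the cell that holds [k+1], and its row is that
    letter. *)
Lemma count_take_row_word (alpha beta : seq nat) (T : tableau alpha beta) r k :
  is_SET T -> k <= ncells alpha beta ->
  count_mem r (take k (row_word T)) =
  \sum_(x | in_shape alpha beta x && (x.1 == r :> nat)) (T x <= k).
Proof.
move=> ST; have /SETP S := ST.
elim: k => [_|k IH kN].
  rewrite take0 big1 // => x /andP[xi _].
  by rewrite leqNgt (SET_pos S xi).
rewrite (take_nth 0) ?size_row_word // -cats1 count_cat (IH (ltnW kN)) /= addn0.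
have -> : \sum_(x | in_shape alpha beta x && (x.1 == r :> nat)) (T x <= k.+1) =
   \sum_(x | in_shape alpha beta x && (x.1 == r :> nat)) (T x <= k) +
   \sum_(x | in_shape alpha beta x && (x.1 == r :> nat)) (T x == k.+1 :> nat).
  by rewrite -big_split; apply: eq_bigr => x _ /=; lia.
congr addn; have [//|y yi ey] := SET_surj S (k := k.+1).
rewrite (nth_row_word ST yi ey); have [yr|yr] := eqVneq (y.1 : nat) r.
  rewrite (bigD1 y) /=; last by rewrite yi yr eqxx.
  rewrite ey eqxx big1 // => x /andP[/andP[xi _] /eqP ny].
  by case: eqP => // ex; case: ny; apply: (SET_inj S xi yi); rewrite ex.
rewrite big1 // => x /andP[xi /eqP xr]; case: eqP => // ex.
by case/eqP: yr; rewrite -xr -(SET_inj S xi yi) // ex.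
Qed.

(** Rows increase, so the cells in the row of [x] with entries at most [T x] are those up to its
    column. Thus the row word records columns as well as rows. *)
Lemma count_take_row_word_cell (alpha beta : seq nat) (T : tableau alpha beta) x :
  is_SET T -> in_shape alpha beta x ->
  count_mem (x.1 : nat) (take (T x) (row_word T)) = x.2 - nth 0 beta x.1.
Proof.
move=> ST xi; rewrite count_take_row_word ?tableau_le //.
have /SETP S := ST; have /andP[xb xa] := xi.
under eq_bigr => y /andP[yi /eqP e].
  rewrite (_ : (T y <= T x) = (y.2 <= x.2)); last first.
    case: (ltngtP y.2 x.2) => l.
    - by rewrite ltnW // (SET_row S).
    - by rewrite leqNgt (SET_row S).
    - by rewrite (cell_eq e l) leqnn.
  over.
rewrite (sum_row beta (fun j => j <= x.2 : nat)) //=.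
rewrite (eq_bigr (fun j : 'I__ => (nth 0 beta x.1 < j <= x.2 : nat))).
  by rewrite sum_interval (minn_idPr (ltn_ord _)) subSS.
move=> j _; rewrite mulnb; congr nat_of_bool.
by case: (leqP j x.2) => [l|_]; rewrite ?andbF // (leq_trans l xa) !andbT.
Qed.

Lemma count_row_word (alpha beta : seq nat) (T : tableau alpha beta) r :
  is_SET T -> r < size alpha ->
  count_mem r (row_word T) = nth 0 alpha r - nth 0 beta r.
Proof.
move=> ST rs.
rewrite -[row_word T]take_size size_row_word count_take_row_word //.
under eq_bigr => y _ do rewrite tableau_le.
rewrite (sum_row beta (fun=> 1)) //=.
under eq_bigr => y _ do rewrite muln1.
by rewrite sum_interval; have := nth_le_bigmax alpha r; lia.
Qed.

(* The j-th letter r of w, counted from 1, is at the least k such that the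
   prefix of length k contains j letters r. *)
Definition word_tableau (alpha beta : seq nat) (w : seq nat) : tableau alpha beta :=
  [ffun x => if in_shape alpha beta x then
     inord (index (x.2 - nth 0 beta x.1)
              [seq count_mem (x.1 : nat) (take k w) | k <- iota 0 (size w).+1])
   else ord0].

(** * Prefix counts and the recovery of a tableau from its row word *)

Lemma leq_count_take (T : eqType) (a : pred T) (w : seq T) i j :
  i <= j -> count a (take i w) <= count a (take j w).
Proof.
by move=> ij; rewrite -(cat_take_drop i (take j w)) take_takel // count_cat leq_addr.
Qed.

Lemma count_takeS (a : pred nat) (w : seq nat) i : i < size w ->
  count a (take i.+1 w) = count a (take i w) + a (nth 0 w i).
Proof. by move=> iw; rewrite (take_nth 0) // -cats1 count_cat /= addn0. Qed.

Lemma count_take_pred (w : seq nat) (r k : nat) :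
  0 < k <= size w -> nth 0 w k.-1 = r ->
  count_mem r (take k w) = (count_mem r (take k.-1 w)).+1.
Proof.
by case: k => // k /andP[_ kw] /= kr; rewrite count_takeS //= kr eqxx addn1.
Qed.

(** A nonempty prefix that ends in [r] has strictly more letters [r] than every shorter prefix. *)
Lemma count_take_inj (w : seq nat) (r i j : nat) :
  0 < i <= size w -> 0 < j <= size w -> nth 0 w i.-1 = r -> nth 0 w j.-1 = r ->
  count_mem r (take i w) = count_mem r (take j w) -> i = j.
Proof.
have lt k l : k < l <= size w -> nth 0 w l.-1 = r ->
    count_mem r (take k w) < count_mem r (take l w).
  case: l => // l /andP[kl lw] lr.
  by rewrite (count_take_pred _ lr) //= ltnS leq_count_take.
move=> /andP[_ iw] /andP[_ jw] ir jr e.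
case: (ltngtP i j) => // l.
  by have := @lt i j; rewrite l jw e ltnn => /(_ isT jr).
by have := @lt j i; rewrite l iw e ltnn => /(_ isT ir).
Qed.

(** Prefix counts start at 0 and grow by at most one, so every [j] up to the total is reached, and
    the first prefix reaching it ends in [r]. *)
Lemma index_countP (w : seq nat) (r j : nat) : 0 < j <= count_mem r w ->
  let k := index j [seq count_mem r (take k w) | k <- iota 0 (size w).+1] in
  [/\ 0 < k <= size w, nth 0 w k.-1 = r & count_mem r (take k w) = j].
Proof.
move=> /andP[j0 jw] k.
have mj : j \in [seq count_mem r (take k w) | k <- iota 0 (size w).+1].
  elim/last_ind: w jw {k} => [|w a IH]; first by rewrite /=; lia.
  rewrite -cats1 count_cat => jw; rewrite /= addn0 in jw.
  have [jl|jl] := leqP j (count_mem r w).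
    have /mapP[k] := IH jl; rewrite mem_iota => kw e.
    apply/mapP; exists k; first by rewrite mem_iota size_cat /=; lia.
    by rewrite takel_cat //; lia.
  apply/mapP; exists (size w).+1; first by rewrite mem_iota size_cat /=; lia.
  rewrite take_oversize ?size_cat ?addn1 // count_cat.
  rewrite /= addn0; apply/eqP; rewrite eqn_leq jw (leq_trans _ jl) //.
  by rewrite -addn1 leq_add2l leq_b1.
have kw : k < (size w).+1.
  rewrite -[(size w).+1](size_iota 0).
  by rewrite -(size_map (fun k => count_mem r (take k w))) index_mem.
have ek : count_mem r (take k w) = j.
  by have := nth_index 0 mj; rewrite (nth_map 0) ?size_iota // nth_iota.
have k0 : 0 < k by case: (k) ek => //; rewrite take0 /=; lia.
split => //; first by rewrite k0.
(* With another last letter, the prefix shorter by one would already contain [j] letters [r],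
   although [k] is the first such index. *)
apply/eqP; apply/negPn/negP => ne.
have kw' : k.-1 < size w by lia.
have := count_takeS (pred1 r) kw'; rewrite prednK // ek /= (negbTE ne) addn0 => ek'.
have lt : k.-1 < k by lia.
have := before_find 0 lt; rewrite (nth_map 0) ?size_iota; last by lia.
by rewrite nth_iota /=; [rewrite -ek' eqxx | lia].
Qed.

Section WordTableau.

Variables (alpha beta : seq nat) (w : seq nat).
Hypothesis w_rows : all (fun r => r < size alpha) w.
Hypothesis w_count : forall r, r < size alpha ->
  count_mem r w = nth 0 alpha r - nth 0 beta r.
Hypothesis w_size : size w = ncells alpha beta.

Let T := word_tableau alpha beta w.

(** By [count_take_inj] these properties pin down the entry; they replace its definition through
    [index]. *)
Lemma word_tableauP x : in_shape alpha beta x ->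
  [/\ 0 < T x <= size w, nth 0 w (T x).-1 = x.1 &
      count_mem (x.1 : nat) (take (T x) w) = x.2 - nth 0 beta x.1].
Proof.
move=> xi; have /andP[xb xa] := xi.
have [|k0 kr kc] := @index_countP w x.1 (x.2 - nth 0 beta x.1).
  rewrite w_count //; lia.
by rewrite /T ffunE xi inordK // -w_size ltnS; case/andP: k0.
Qed.

Lemma word_tableau_surj k : 0 < k <= size w ->
  exists2 x, in_shape alpha beta x & T x = k :> nat.
Proof.
move=> /andP[k0 kw]; set r := nth 0 w k.-1.
have kw' : k.-1 < size w by lia.
have rs : r < size alpha by apply: (allP w_rows); rewrite mem_nth.
have ck : count_mem r (take k w) = (count_mem r (take k.-1 w)).+1.
  by rewrite -{1}(prednK k0) count_takeS //= eqxx addn1.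
have : count_mem r (take k w) <= count_mem r w.
  by rewrite -{2}[w]take_size leq_count_take.
rewrite w_count // => cr.
have [|x xr xc] := @exists_cell alpha r (nth 0 beta r + count_mem r (take k w)) rs.
  lia.
have xi : in_shape alpha beta x by rewrite /in_shape xr xc; lia.
have [tw] := word_tableauP xi; rewrite xr xc addKn => tr tc.
by exists x => //; apply: (count_take_inj tw _ tr _ tc); rewrite ?k0.
Qed.

(** Bijectivity and increasing rows follow from the letter counts; only the columns depend on how
    different letters are interleaved. *)
Lemma word_tableau_SET :
  (forall x y, in_shape alpha beta x -> in_shape alpha beta y ->
    x.2 = y.2 :> nat -> x.1 < y.1 -> T x < T y) -> is_SET T.
Proof.
move=> col; apply/SETP; split=> //.
- by move=> x /negbTE xo; rewrite ffunE xo.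
- by move=> x /word_tableauP[/andP[]].
- move=> x y xi yi e.
  have [_ xr xc] := word_tableauP xi; have [_ yr yc] := word_tableauP yi.
  have e1 : x.1 = y.1 :> nat by rewrite -xr -yr e.
  have e2 : x.2 - nth 0 beta y.1 = y.2 - nth 0 beta y.1.
    by rewrite -{1}e1 -xc -yc e e1.
  have [/andP[xb _] /andP[yb _]] := (xi, yi); rewrite e1 in xb.
  by apply: cell_eq => //; move: xb yb e2; lia.
- by move=> k kN; apply: word_tableau_surj; rewrite w_size.
- move=> x y xi yi e l; rewrite ltnNge; apply/negP.
  have [_ xr xc] := word_tableauP xi; have [_ yr yc] := word_tableauP yi.
  move/(leq_count_take (pred1 (x.1 : nat)) w).
  rewrite {1}e yc xc e.
  have [/andP[xb _] /andP[yb _]] := (xi, yi); rewrite e in xb.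
  by move: xb yb l; lia.
Qed.

Lemma row_word_tableau : is_SET T -> row_word T = w.
Proof.
move=> ST; apply: (@eq_from_nth _ 0); rewrite size_row_word // => i iN.
have [|x xi ex] := @word_tableau_surj i.+1; first by rewrite w_size.
rewrite (nth_row_word ST xi ex).
by have [_ <-] := word_tableauP xi; rewrite ex.
Qed.

End WordTableau.

(** Both entries of a cell end prefixes with the same number of letters [x.1], and both prefixes end
    in that letter, so [count_take_inj] identifies them. *)
Lemma row_wordK (alpha beta : seq nat) (T : tableau alpha beta) :
  is_SET T -> word_tableau alpha beta (row_word T) = T.
Proof.
move=> ST; have /SETP S := ST; apply/ffunP=> x; apply: val_inj; rewrite ffunE.
case: ifP => [xi|/negbT xo]; last by rewrite /= (SET_out S xo).
have xa : x.1 < size alpha by exact: ltn_ord.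
have t0 := SET_pos S xi; have tN := tableau_le T x.
have tc := count_take_row_word_cell ST xi.
have [|kw kr kc] := @index_countP (row_word T) x.1 (x.2 - nth 0 beta x.1).
  rewrite (count_row_word ST xa); move: xi; rewrite /in_shape /=; lia.
rewrite /= inordK; last by rewrite ltnS -(size_row_word T); case/andP: kw.
have tr : nth 0 (row_word T) (T x).-1 = x.1 by apply: nth_row_word; rewrite ?prednK.
by apply: (count_take_inj kw _ kr tr); rewrite ?tc // t0 size_row_word.
Qed.

(** * Row words of minimal lobster tableaux *)

(* Whether row letter a may follow the letter l in the row word of a minimal
   tableau, when z letters 0 and t letters 2 precede a.  The ascents 01 and 12
   are forbidden, 02 is allowed only inside one column, and the condition on
   z and t.+1 is that columns increase. *)
Definition may_follow (c2 z t l a : nat) : bool :=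
  match a with
  | 0 => true
  | 1 => l != 0
  | 2 => [&& l != 1, (l == 0) ==> (z == t.+1) & minn t.+1 c2 <= z]
  | _ => false
  end.

(** The state is the numbers [z], [t] of letters 0 and 2 read so far and the last letter [l]. A full
    run starts with [l = 2], since a last letter 2 restricts no successor. *)
Fixpoint minimal_from (c1 c2 z t l : nat) (u : seq nat) : bool :=
  if u is a :: u' then
    may_follow c2 z t l a && minimal_from c1 c2 (z + (a == 0)) (t + (a == 2)) a u'
  else (z == c2) && (t == c1).

Lemma minimal_fromP c1 c2 z t l u :
  reflect [/\ z + count_mem 0 u = c2, t + count_mem 2 u = c1 &
    forall i, i < size u -> may_follow c2 (z + count_mem 0 (take i u))
       (t + count_mem 2 (take i u)) (nth 0 (l :: u) i) (nth 0 u i)]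
   (minimal_from c1 c2 z t l u).
Proof.
elim: u z t l => [|a u IH] z t l /=.
  by rewrite !addn0; apply: (iffP andP) => [[/eqP-> /eqP->]|[-> -> _]].
apply: (iffP andP) => [[af /IH[ez et nf]]|[ez et nf]]; split.
- by rewrite -ez addnA.
- by rewrite -et addnA.
- by case=> [|i] /=; rewrite ?addn0 ?addnA //; apply: nf.
- by have := nf 0 isT; rewrite /= !addn0.
- by apply/IH; split; rewrite -?addnA // => i iu; have := nf i.+1 iu; rewrite /= !addnA.
Qed.

(** * Accepted words are exactly the block expansions *)

Fixpoint expand (c1 c2 : nat) (s : seq bool) : seq nat :=
  if s is B :: s' then
    if B then 1 :: expand c1 c2 s'
    else 0 :: 2 :: nseq (if all id s' then c1 - c2 else 0) 2 ++ expand c1 c2 s'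
  else nseq (c2 - c1) 0.

Lemma minimal_from_le c1 c2 z t l u : minimal_from c1 c2 z t l u -> z <= c2 /\ t <= c1.
Proof. by move=> /minimal_fromP[<- <- _]; rewrite !leq_addr. Qed.

(** After a 0 the letter 1 is forbidden, and 2 is excluded because [z] exceeds [t+1] or the top claw
    is full. Reading further zeros preserves either reason. *)
Lemma minimal_from_zeros c1 c2 z t u : (t.+1 < z) || (t == c1) ->
  minimal_from c1 c2 z t 0 u -> t = c1 /\ u = nseq (c2 - z) 0.
Proof.
elim: u z => [|[|[|[|a]]] u IH] z tz //=.
- by move=> /andP[/eqP <- /eqP->]; rewrite subnn.
- rewrite addn1 addn0 => gu; have [] := IH _ _ gu; first by lia.
  have [] := minimal_from_le gu => zc _ -> ->; split => //.
  by rewrite (_ : c2 - z = (c2 - z.+1).+1) //; lia.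
- by rewrite addn1 => /andP[? /minimal_from_le[]]; lia.
Qed.

(** The top claw is full, so no 2 remains, and once a 0 is read only zeros can follow. *)
Lemma minimal_from_ones c1 c2 z l u : l != 0 -> minimal_from c1 c2 z c1 l u ->
   exists m, u = nseq m 1 ++ nseq (c2 - z) 0.
Proof.
elim: u l => [|[|[|[|a]]] u IH] l l0 //=.
- by move=> /andP[/eqP -> _]; exists 0; rewrite subnn.
- rewrite addn1 addn0 => gu; have [zc _] := minimal_from_le gu.
  have [|_ ->] := minimal_from_zeros _ gu; first by rewrite eqxx orbT.
  by exists 0; rewrite (_ : c2 - z = (c2 - z.+1).+1) //; lia.
- by rewrite !addn0 => /andP[_ /IH[//|m ->]]; exists m.+1.
- by rewrite addn1 => /andP[_ /minimal_from_le[]]; lia.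
Qed.

Lemma minimal_from_after_one c1 c2 t u : minimal_from c1 c2 c2 t 1 u -> t = c1.
Proof.
elim: u => [|[|[|[|a]]] u IH] //=.
- by move=> /andP[_ /eqP].
- by rewrite addn1 => /minimal_from_le[]; lia.
- by rewrite !addn0.
Qed.

(** The bottom claw is full, and the missing letters 2 must precede the first 1 because 12 is
    forbidden. *)
Lemma minimal_from_twos c1 c2 t u : minimal_from c1 c2 c2 t 2 u ->
   exists m, u = nseq (c1 - t) 2 ++ nseq m 1.
Proof.
elim: u t => [|[|[|[|a]]] u IH] t //=.
- by move=> /andP[_ /eqP->]; exists 0; rewrite subnn.
- by rewrite addn1 => /minimal_from_le[]; lia.
- rewrite !addn0 => gu; have tc := minimal_from_after_one gu; rewrite tc in gu *.
  have [//|m ->] := minimal_from_ones _ gu.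
  by exists m.+1; rewrite !subnn cats0.
- rewrite addn1 addn0 => /andP[_ gu]; have [_ tc] := minimal_from_le gu.
  have [m ->] := IH _ gu; exists m.
  by rewrite (_ : c1 - t = (c1 - t.+1).+1) //; lia.
Qed.

Lemma expand_nseq_true c1 c2 m :
  expand c1 c2 (nseq m true) = nseq m 1 ++ nseq (c2 - c1) 0.
Proof. by elim: m => //= m ->. Qed.

Lemma count_id_negb (s : seq bool) : count id s + count negb s = size s.
Proof. exact: count_predC. Qed.

(** With [z = t] and neither claw full, a 2 violates the column condition, so the next letter is 1
    or 0. A 0 must be followed by 2, which restores [z = t]. The block 02 consumes two letters,
    hence the induction on a bound for the length. *)
Lemma minimal_from_expand c1 c2 z l u : l != 0 -> z < minn c1 c2 ->
  minimal_from c1 c2 z z l u ->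
  exists2 s, u = expand c1 c2 s & count negb s = minn c1 c2 - z.
Proof.
have [n] := ubnP (size u); elim: n z l u => // n IH z l [|[|[|[|a]]] u] /= un l0 zc //.
- by lia.
- rewrite addn1 addn0; case: u un => [|[|[|[|a]]] u] //= un.
  + by lia.
  (* A second 0 would leave only zeros and force [z = c1], against [z < c1]. *)
  + rewrite addn1 addn0 => /minimal_from_zeros[|zE _]; first by rewrite ltnSn.
    by lia.
  + rewrite addn0 addn1 => /andP[_ gu].
    have [zc'|zc'] := ltnP z.+1 (minn c1 c2).
      have [||s -> sc] := IH _ _ _ _ _ zc' gu; [by lia|by []|].
      exists (false :: s) => /=; last by lia.
      (* [s] still contains a [false], so this block is not the last one and no surplus follows
         it. *)
      rewrite all_count (_ : (_ == _) = false) //.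
      by have := count_id_negb s; lia.
    (* At least one claw is now full; truncated subtraction merges the two cases into one
       formula. *)
    have [m ->] : exists m, u = nseq (c1 - c2) 2 ++ nseq m 1 ++ nseq (c2 - c1) 0.
      case: (leqP c2 c1) zc zc' => c21 zc zc'.
        have zE : z.+1 = c2 by lia.
        rewrite zE in gu; have [m ->] := minimal_from_twos gu.
        by exists m; rewrite (_ : c2 - c1 = 0) ?cats0 //; lia.
      have zE : z.+1 = c1 by lia.
      rewrite zE in gu; have [//|m ->] := minimal_from_ones _ gu.
      by exists m; rewrite (_ : c1 - c2 = 0) //; lia.
    exists (false :: nseq m true) => /=.
      by rewrite expand_nseq_true all_nseq orbT.
    by rewrite count_nseq /=; lia.
- rewrite !addn0 => /andP[_ gu].
  have [||s -> sc] := IH _ _ _ _ _ zc gu; [by lia|by []|].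
  by exists (true :: s).
- by lia.
Qed.

(** Some C must be left, because surplus letters 2 are attached to the last one. The tail after it
    is checked by the auxiliary facts [twos], [ones] and [zeros]. *)
Lemma expand_minimal_from c1 c2 z l s : l != 0 -> z + count negb s = minn c1 c2 ->
  count negb s != 0 -> minimal_from c1 c2 z z l (expand c1 c2 s).
Proof.
have zeros k z' t l' : z' + k = c2 -> t = c1 -> minimal_from c1 c2 z' t l' (nseq k 0).
  elim: k z' l' => [|k IHk] z' l' /=; first by rewrite addn0 => -> ->; rewrite !eqxx.
  by move=> e tc; rewrite addn1 addn0; apply: IHk => //; lia.
have ones s' z' l' : all id s' -> l' != 0 -> z' + (c2 - c1) = c2 ->
    minimal_from c1 c2 z' c1 l' (expand c1 c2 s').
  elim: s' l' => [|[] s' IHs] l' //=; first by move=> _ _ e; apply: zeros.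
  by move=> a -> e; rewrite !addn0; apply: IHs.
have twos s' k t : all id s' -> c2 <= t -> t + k = c1 ->
    minimal_from c1 c2 c2 t 2 (nseq k 2 ++ expand c1 c2 s').
  move=> a; elim: k t => [|k IHk] t ct /=.
    by rewrite addn0 => tc; rewrite tc; apply: ones => //; lia.
  by move=> e; rewrite addn0 addn1 geq_minr; apply: IHk; lia.
elim: s z l => [|[] s IH] z l l0 //=; first by move=> zs ns; rewrite l0 !addn0; apply: IH.
rewrite /= !addn0 !addn1 eqxx geq_minl /= => zs _.
case: ifP => [a|/negbT na]; last first.
  apply: IH => //; first by lia.
  move: na; rewrite all_count; apply: contraNneq => ns.
  by have := count_id_negb s; rewrite ns; lia.
have ns : count negb s = 0.
  by move: a; rewrite all_count => /eqP; have := count_id_negb s; lia.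
case: (leqP c2 c1) zs => c21; rewrite ns => zs.
  by rewrite (_ : z.+1 = c2); [apply: twos|]; lia.
rewrite (_ : c1 - c2 = 0) /=; last by lia.
by rewrite (_ : z.+1 = c1); [apply: ones|]; lia.
Qed.

Lemma minimal_from_letters c1 c2 z t l u :
  minimal_from c1 c2 z t l u -> all (fun r => r < 3) u.
Proof. by elim: u z t l => [|[|[|[|a]]] u IH] z t l //=; [apply: IH | case/andP=> _ /IH..]. Qed.

Lemma count1_expand c1 c2 s : count_mem 1 (expand c1 c2 s) = count id s.
Proof.
elim: s => [|[] s IH] /=; first by rewrite count_nseq.
  by rewrite IH.
by rewrite count_cat count_nseq IH.
Qed.

(** Equal sizes and counts give both tails the same number of letters C, so the surplus runs have
    equal length and cancel. *)
Lemma expand_inj c1 c2 s1 s2 : size s1 = size s2 -> count id s1 = count id s2 ->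
  expand c1 c2 s1 = expand c1 c2 s2 -> s1 = s2.
Proof.
elim: s1 s2 => [|[] s1 IH] [|[] s2] //= [sz].
  by rewrite !add1n => -[ct] [e]; rewrite (IH s2).
rewrite !add0n => ct []; rewrite !all_count ct sz => /eqP.
by rewrite eqseq_cat // => /andP[_ /eqP e]; rewrite (IH s2).
Qed.

(** * Passing between minimal lobster tableaux and accepted words *)

Lemma lobster_ncells b c1 c2 :
  ncells (lobster_alpha b c1 c2) (lobster_beta b) = b + c1 + c2.
Proof. by rewrite ncells_sum !big_ord_recl big_ord0 /=; lia. Qed.

Lemma lobster_rowP b c1 c2 (x : cell (lobster_alpha b c1 c2)) :
  [\/ x.1 = 0 :> nat, x.1 = 1 :> nat | x.1 = 2 :> nat].
Proof. by case: x => [[[|[|[|r]]] lr] j] //=; [constructor 1|constructor 2|constructor 3]. Qed.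

Lemma lobster_bottom b c1 c2 j : 0 < j <= c2 ->
  exists x : cell (lobster_alpha b c1 c2),
    [/\ in_shape (lobster_alpha b c1 c2) (lobster_beta b) x,
        x.1 = 0 :> nat & x.2 = b.+1 + j :> nat].
Proof.
move=> /andP[j0 j2].
have [||x x1 x2] := @exists_cell (lobster_alpha b c1 c2) 0 (b.+1 + j) => //=; first by lia.
by exists x; rewrite /in_shape x1 x2 /=; split => //; lia.
Qed.

Lemma lobster_top b c1 c2 j : 0 < j <= c1 ->
  exists x : cell (lobster_alpha b c1 c2),
    [/\ in_shape (lobster_alpha b c1 c2) (lobster_beta b) x,
        x.1 = 2 :> nat & x.2 = b.+1 + j :> nat].
Proof.
move=> /andP[j0 j1].
have [||x x1 x2] := @exists_cell (lobster_alpha b c1 c2) 2 (b.+1 + j) => //=; first by lia.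
by exists x; rewrite /in_shape x1 x2 /=; split => //; lia.
Qed.

(** The body ends in column [b+1] and the claws begin one column later, so the cells of an ascent 01
    or 12 never share a column. Only 02 survives, and there equal columns mean [z = t+1]. *)
Lemma minimal_row_word b c1 c2 (T : tableau (lobster_alpha b c1 c2) (lobster_beta b)) :
  0 < c2 -> is_SET T -> locally_minimal T -> minimal_from c1 c2 0 0 2 (row_word T).
Proof.
move=> c20 ST lT; have /SETP S := ST.
apply/minimal_fromP; split.
- by rewrite (count_row_word ST) //=; lia.
- by rewrite (count_row_word ST) //=; lia.
move=> i; rewrite size_row_word !add0n => iN.
have [//|x xi ex] := SET_surj S (k := i.+1).
have /andP[xb xa] := xi.
(* At [i = 0] the preceding letter is the initial 2 of the run. *)
have prev : i = 0 \/ exists y,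
    [/\ in_shape (lobster_alpha b c1 c2) (lobster_beta b) y, T y = i :> nat &
    nth 0 (2 :: row_word T) i = y.1].
  case: i iN ex => [|i] iN ex; first by left.
  right; have [|y yi ey] := SET_surj S (k := i.+1); first by lia.
  by exists y; split; [exact: yi | exact: ey | exact: (nth_row_word ST yi ey)].
rewrite (nth_row_word ST xi ex).
have [x1|x1|x1] := lobster_rowP x; rewrite x1 //=; rewrite x1 /= in xb xa.
  case: prev => [->//|[y [yi ey ->]]]; apply/negP => /eqP y1.
  have := lT y x yi xi; rewrite ex ey y1 x1 => /(_ erefl isT) e.
  by move: yi xb xa; rewrite /in_shape y1 e /=; lia.
have xc : (count_mem 2 (take i (row_word T))).+1 = x.2 - b.+1.
  have := count_take_row_word_cell ST xi; rewrite ex x1 /= => <-.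
  by rewrite count_takeS ?size_row_word //= (nth_row_word ST xi ex) x1 addn1.
apply/and3P; split.
- case: prev => [->//|[y [yi ey ->]]]; apply/negP => /eqP y1.
  have := lT y x yi xi; rewrite ex ey y1 x1 => /(_ erefl isT) e.
  by move: yi xb xa; rewrite /in_shape y1 e /=; lia.
- apply/implyP; case: prev => [->//|[y [yi ey ->]]] /eqP y1.
  have := lT y x yi xi; rewrite ex ey y1 x1 => /(_ erefl isT) e.
  by rewrite xc; have := count_take_row_word_cell ST yi; rewrite ey y1 /= e => ->.
(* [j] is the last column of the bottom claw, counted from [b+2] as 1, that is not to the right of
   [x]. Its cells [y] and [z] satisfy [T y < T z <= T x], so at least [j] letters 0 precede [x]. *)
rewrite xc; set j := minn _ _.
have j0 : 0 < j <= c2 by rewrite /j; lia.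
have [y [yi y1 y2]] := lobster_bottom b c1 j0.
have [|z [zi z1 z2]] := @lobster_top b c1 c2 j.
  by case/andP: j0 => -> _; rewrite (leq_trans (geq_minl _ _)) // leq_subLR.
have lyz : T y < T z by apply: (SET_col S) => //; rewrite ?y1 ?z1 ?y2.
have lzx : T z <= T x.
  have [e|l] := eqVneq (z.2 : nat) x.2; first by rewrite (cell_eq _ e) // z1 x1.
  apply/ltnW/(SET_row S) => //; first by rewrite z1 x1.
  by rewrite ltn_neqAle l z2 -leq_subRL ?geq_minl // ltnW.
have yc := count_take_row_word_cell ST yi.
have -> : j = count_mem 0 (take (T y) (row_word T)).
  by move: yc; rewrite y1 y2 /= => ->; lia.
by apply: leq_count_take; rewrite -ltnS -ex (leq_trans lyz).
Qed.

Lemma size_row_letters (w : seq nat) : all (fun r => r < 3) w ->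
  size w = count_mem 0 w + count_mem 1 w + count_mem 2 w.
Proof.
elim: w => //= a w IH /andP[a3 /IH ->].
by case: a a3 => [|[|[|a]]] //= _; rewrite ?add0n ?add1n ?addSn ?addnS.
Qed.

Lemma minimal_from_tableau b c1 c2 (w : seq nat)
    (T := word_tableau (lobster_alpha b c1 c2) (lobster_beta b) w) :
  minimal_from c1 c2 0 0 2 w -> count_mem 1 w = b ->
  [/\ is_SET T, locally_minimal T & row_word T = w].
Proof.
move=> mw w1; have w3 := minimal_from_letters mw.
have /minimal_fromP[] := mw; rewrite !add0n => w0 w2 wf.
have wrows : all (fun r => r < size (lobster_alpha b c1 c2)) w by [].
have wcount r : r < size (lobster_alpha b c1 c2) ->
    count_mem r w = nth 0 (lobster_alpha b c1 c2) r - nth 0 (lobster_beta b) r.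
  by case: r => [|[|[|r]]] //= _; rewrite ?w0 ?w1 ?w2 ?addKn ?subn1.
have wsize : size w = ncells (lobster_alpha b c1 c2) (lobster_beta b).
  by rewrite lobster_ncells size_row_letters // w0 w1 w2; lia.
have P := word_tableauP wrows wcount wsize.
have ST : is_SET T.
  apply: (word_tableau_SET wrows wcount wsize) => x y xi yi e l.
  (* Only the two claws share columns. *)
  have [x1 y1] : x.1 = 0 :> nat /\ y.1 = 2 :> nat.
    move: xi yi; rewrite /in_shape e.
    have [x1|x1|x1] := lobster_rowP x; have [y1|y1|y1] := lobster_rowP y;
      rewrite x1 y1 /=; rewrite x1 y1 // in l; lia.
  have [tx xr xc] := P _ xi; have [ty yr yc] := P _ yi.
  rewrite x1 /= in xr xc; rewrite y1 /= in yr yc.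
  (* If [T y <= T x], the prefix before [y] would have as many letters 0 as the claw column of [y],
     but the prefix before [x] has one fewer than that same column. *)
  rewrite ltnNge; apply/negP => lt.
  have iw : (T y).-1 < size w by rewrite /T; lia.
  have := wf _ iw; rewrite !add0n yr /= => /and3P[_ _].
  have -> : (count_mem 2 (take (T y).-1 w)).+1 = y.2 - b.+1.
    by rewrite -yc -(count_take_pred ty yr).
  move=> zc; have jw : (T x).-1 < size w by rewrite /T; lia.
  have xc' : (count_mem 0 (take (T x).-1 w)).+1 = x.2 - b.+1.
    by rewrite -xc -(count_take_pred tx xr).
  have : (T y).-1 <= (T x).-1 by move: lt; rewrite /T; lia.
  move/(leq_count_take (pred1 0) w)/(leq_trans zc).
  rewrite -ltnS xc' e (minn_idPl _) ?ltnn //.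
  by have /andP[_] := xi; rewrite x1 e /= leq_subLR.
split=> //; last exact: (row_word_tableau wrows wcount wsize).
move=> x y xi yi e l.
have [tx xr xc] := P _ xi; have [ty yr yc] := P _ yi.
rewrite -/T e /= in yr.
have iw : T x < size w by rewrite -e; case/andP: ty.
have := wf _ iw; rewrite !add0n yr.
have -> : nth 0 (2 :: w) (T x) = x.1.
  by rewrite -xr; case/andP: tx; rewrite -/T; case: (T x : nat).
have [x1|x1|x1] := lobster_rowP x; have [y1|y1|y1] := lobster_rowP y;
  rewrite x1 y1 //= in l *.
(* Only the ascent 02 is left, and [zt] equates the claw columns of its cells. *)
move=> /andP[/eqP zt _]; rewrite x1 /= in xc; rewrite y1 /= in yc.
have e2 : x.2 - b.+1 = y.2 - b.+1.
  rewrite -xc -yc zt -/T e count_takeS //= yr y1 addn1 //.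
move: xi yi; rewrite /in_shape x1 y1 => /andP[/ltnW xb _] /andP[/ltnW yb _].
by rewrite -(subnK xb) -(subnK yb) [_ - _]e2.
Qed.

(** * The column tableau *)

Definition col_le (alpha : seq nat) (y x : cell alpha) : bool :=
  (y.2 < x.2) || ((y.2 == x.2) && (y.1 <= x.1)).

Lemma col_leE (alpha : seq nat) (y x : cell alpha) :
  col_le y x = (y.2 < x.2) || ((y.2 == x.2 :> nat) && (y.1 <= x.1)).
Proof. by []. Qed.

Lemma col_le_trans (alpha : seq nat) : transitive (@col_le alpha).
Proof.
by move=> y x z; rewrite !col_leE; lia.
Qed.

Lemma col_le_total (alpha : seq nat) (x y : cell alpha) : col_le x y || col_le y x.
Proof. by rewrite !col_leE; lia. Qed.

Lemma col_le_anti (alpha : seq nat) (x y : cell alpha) :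
  col_le x y -> col_le y x -> x = y.
Proof.
by rewrite !col_leE => l1 l2; apply: cell_eq; move: l1 l2; lia.
Qed.

Definition col_before (alpha beta : seq nat) (x : cell alpha) : {set cell alpha} :=
  [set y | in_shape alpha beta y && col_le y x].

Lemma ScolE (alpha beta : seq nat) x : in_shape alpha beta x ->
  Scol alpha beta x = #|col_before beta x| :> nat.
Proof.
move=> xi; rewrite ffunE xi inordK; first by rewrite cardsE.
by rewrite ltnS; apply/subset_leq_card/subsetP => y; rewrite !inE => /andP[].
Qed.

(** An entry is the size of an initial segment of the total order [col_le], and these segments are
    nested like their last cells. *)
Lemma Scol_lt (alpha beta : seq nat) x y :
  in_shape alpha beta x -> in_shape alpha beta y ->
  (Scol alpha beta x < Scol alpha beta y) = ~~ col_le y x.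
Proof.
have sub u v : col_le u v -> col_before beta u \subset col_before beta v.
  move=> l; apply/subsetP => z; rewrite !inE => /andP[-> /=] zu.
  exact: col_le_trans l.
move=> xi yi; rewrite !ScolE //; case yx: (col_le y x).
  by rewrite ltnNge subset_leq_card // sub.
have := col_le_total x y; rewrite yx orbF => xy; apply/proper_card/properP; split; first exact: sub.
by exists y; rewrite !inE ?yx ?andbF // yi col_leE eqxx leqnn orbT.
Qed.

Lemma Scol_inj (alpha beta : seq nat) x y :
  in_shape alpha beta x -> in_shape alpha beta y ->
  Scol alpha beta x = Scol alpha beta y :> nat -> x = y.
Proof.
move=> xi yi e; have := Scol_lt xi yi; have := Scol_lt yi xi.
rewrite e ltnn => /esym/negbFE xy /esym/negbFE yx; exact: col_le_anti.
Qed.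

Lemma Scol_SET (alpha beta : seq nat) : is_SET (Scol alpha beta).
Proof.
have pos x : in_shape alpha beta x -> 0 < Scol alpha beta x.
  move=> xi; rewrite ScolE // card_gt0; apply/set0Pn; exists x.
  by rewrite !inE xi col_leE eqxx leqnn orbT.
apply/SETP; split=> //.
- by move=> x /negbTE xo; rewrite ffunE xo inordK.
- exact: Scol_inj.
- move=> k /andP[k0 kN].
  pose A := [set x | in_shape alpha beta x].
  (* Surjectivity comes from counting: an injective map from the cells into equally many nonzero
     values. *)
  have AE : Scol alpha beta @: A = [set~ ord0].
    apply/eqP; rewrite eqEcard; apply/andP; split.
      apply/subsetP => _ /imsetP[x xi ->]; rewrite !inE in xi *.
      by apply: contraTneq (pos x xi) => ->.
    rewrite cardsC1 card_ord card_in_imset; first by rewrite /A cardsE.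
    by move=> x y; rewrite !inE => xi yi e; apply: (Scol_inj xi yi); rewrite e.
  have : inord k \in Scol alpha beta @: A.
    by rewrite AE !inE; apply/eqP => /(congr1 val); rewrite /= inordK //; lia.
  case/imsetP => x; rewrite inE => xi /(congr1 val); rewrite /= inordK // => ->.
  by exists x.
- by move=> x y xi yi e l; rewrite Scol_lt // col_leE; lia.
- by move=> x y xi yi e l; rewrite Scol_lt // col_leE; lia.
Qed.

(** Consecutive entries have no cell strictly between them in column order. An ascent across
    different columns always has one: above [x] in the top claw for 02, the first bottom claw cell
    for 12. An ascent 01 would run leftward. *)
Lemma Scol_locally_minimal b c1 c2 : 0 < c2 ->
  locally_minimal (Scol (lobster_alpha b c1 c2) (lobster_beta b)).
Proof.
move=> c20 x y xi yi e l; set T := Scol _ _ in e.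
have between z : in_shape _ (lobster_beta b) z -> ~~ col_le z x -> ~~ col_le y z -> False.
  by move=> zi; rewrite -(Scol_lt xi zi) -(Scol_lt zi yi) -/T => l1; rewrite e ltnS leqNgt l1.
have yx : ~~ col_le y x by rewrite -(Scol_lt xi yi) -/T e.
apply/eqP; apply/negPn/negP => ne; rewrite col_leE in yx.
have [x1|x1|x1] := lobster_rowP x; have [y1|y1|y1] := lobster_rowP y;
  rewrite x1 y1 // in l.
- by move: xi yi yx; rewrite /in_shape x1 y1 /=; lia.
- have [||z z1 z2] := @exists_cell (lobster_alpha b c1 c2) 2 x.2 => //=.
    by move: yi yx; rewrite /in_shape x1 y1 /=; lia.
  apply: (between z); rewrite ?col_leE ?z1 ?z2 ?x1 ?y1; try lia.
  by move: xi yi yx; rewrite /in_shape x1 y1 z1 z2 /=; lia.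
- have [|z [zi z1 z2]] := @lobster_bottom b c1 c2 1; first by lia.
  apply: (between z) => //; rewrite ?col_leE ?z1 ?z2 ?x1 ?y1;
    by move: xi yi; rewrite /in_shape x1 y1 /=; lia.
Qed.

(** * Counting *)

(** Boolean tuples are indicator functions of subsets of ['I_n], and the count is the
    cardinality. *)
Lemma card_count_tuples n k :
  #|[pred w : n.-tuple bool | count id w == k]| = 'C(n, k).
Proof.
pose f (w : n.-tuple bool) := [set i | tnth w i].
have f_inj : injective f.
  by move=> u v /setP e; apply: eq_from_tnth => i; have := e i; rewrite !inE.
have f_card w : #|f w| = count id w.
  by rewrite cardsE -sum1_card -sum1_count big_tuple.
rewrite -[n in RHS]card_ord -card_draws -cardsE -(card_imset _ f_inj).
apply: eq_card => A; rewrite inE; apply/imsetP/idP => [[w]|Ak].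
  by rewrite !inE /= -f_card => wk ->.
have fA : f [tuple i \in A | i < n] = A.
  by apply/setP => i; rewrite inE tnth_mktuple.
have fc := f_card [tuple i \in A | i < n]; rewrite fA in fc.
rewrite inE in Ak.
by exists [tuple i \in A | i < n]; rewrite ?fA // inE -fc.
Qed.

Theorem theorem5p4 (b c1 c2 : nat) :
  0 < b -> 0 < c1 -> 0 < c2 ->
  (exists f : {T : tableau (lobster_alpha b c1 c2) (lobster_beta b) |
                 is_minimal T} -> BCword b (minn c1 c2),
     bijective f)
  /\ #|[set T : tableau (lobster_alpha b c1 c2) (lobster_beta b) | is_minimal T]|
       = 'C(b + minn c1 c2, b)
  /\ is_minimal (Scol (lobster_alpha b c1 c2) (lobster_beta b)).
Proof.
move=> b0 c10 c20; set c := minn c1 c2.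
pose M := {T : tableau (lobster_alpha b c1 c2) (lobster_beta b) | is_minimal T}.
pose W := {w : (b + c).-tuple bool | count id w == b}.
have expandP (w : W) : let T := word_tableau (lobster_alpha b c1 c2) (lobster_beta b)
    (expand c1 c2 (val w)) in is_minimal T /\ row_word T = expand c1 c2 (val w).
  case: w => w /= /eqP wb.
  have wc : count negb w = c.
    have := count_id_negb w; rewrite size_tuple; lia.
  have [||ST lT ->] := @minimal_from_tableau b c1 c2 (expand c1 c2 w).
  - by apply: expand_minimal_from; rewrite ?wc //; lia.
  - by rewrite count1_expand.
  by split=> //; apply/is_minimalP.
(* The explicit map goes from words to tableaux; the required bijection is its inverse, obtained by
   choosing preimages. *)
pose g (w : W) : M := Sub _ (expandP w).1.
have g_inj : injective g.
  move=> w1 w2 /(congr1 (fun T : M => row_word (val T))) /=.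
  rewrite (expandP w1).2 (expandP w2).2 => e.
  apply/val_inj/val_inj/(expand_inj _ _ e); first by rewrite !size_tuple.
  by rewrite (eqP (valP w1)) (eqP (valP w2)).
have g_surj (T : M) : exists w, g w == T.
  case: T => T mT; have /is_minimalP[ST lT] := mT.
  have mw := minimal_row_word c20 ST lT.
  have cpos : 0 < minn c1 c2 by rewrite leq_min c10.
  (* The run starts at [z = t = 0], so both claws being nonempty is what starts the block
     decomposition. *)
  have [s sE sc] := minimal_from_expand (isT : 2 != 0) cpos mw.
  have s1 : count id s = b.
    by rewrite -(count1_expand c1 c2) -sE (count_row_word ST) //=; lia.
  have ss : size s == b + c.
    have := count_id_negb s; rewrite s1 sc; lia.
  have wb : count id (Tuple ss) == b by rewrite /= s1.
  exists (Sub (Tuple ss) wb); apply/eqP/val_inj.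
  by rewrite /= -sE row_wordK.
have gK : cancel (fun T => xchoose (g_surj T)) g.
  by move=> T; apply/eqP/(xchooseP (g_surj T)).
have f_bij : bijective (fun T => xchoose (g_surj T)).
  by exists g => // w; apply: g_inj; rewrite gK.
split; first by exists (fun T => xchoose (g_surj T)).
split; last first.
  by apply/is_minimalP; split; [apply: Scol_SET | apply: Scol_locally_minimal].
rewrite cardsE -(card_sig [pred T | is_minimal T]) (bij_eq_card f_bij) card_sig.
exact: card_count_tuples.
Qed.
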